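(* There exists a proper translation-invariant distance $d$ on $\mathbb{R}$, inducing the standard topology of $\mathbb{R}$, such that $(\mathbb{R},d)$ has Assouad dimension $1$, Nagata dimension $1$, but is not locally biLipschitz homeomorphic to the Euclidean line.
   Context: A distance $d$ on $\mathbb{R}$ is translation-invariant if $d(x,y)=d(x+v,y+v)$ for all $x,y,v\in\mathbb{R}$. A distance is proper if all its closed balls are compact. Nagata dimension: for a cover $\mathcal{B}$ of a metric space $X$ and $s>0$, the $s$-multiplicity of $\mathcal{B}$ is the infimum of all $n$ such that every subset of $X$ of diameter $\le s$ meets at most $n$ members of $\mathcal{B}$. The cover $\mathcal{B}$ is $D$-bounded if $\operatorname{diam} B\le D$ for all $B\in\mathcal{B}$. The Nagata dimension of $X$ is the infimum of all integers $n\geq 0$ for which there exists a constant $c>0$ such that, for all $s>0$, $X$ admits a $cs$-bounded cover with $s$-multiplicity at most $n+1$. The Assouad dimension of a metric space $X$ is the infimum of all numbers $\beta>0$ for which there is some $C>1$ such that, for all $D>0$ and all $\epsilon\in(0,1)$, every set of diameter $D$ can be covered by at most $C\epsilon^{-\beta}$ sets of diameter at most $\epsilon D$. A metric space is locally biLipschitz homeomorphic to the Euclidean line if every point has an open neighborhood that is biLipschitz homeomorphic to an open subset of $\mathbb{R}$ with the Euclidean distance. *)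

(* Defs.v *)
From HB Require Import structures.
From mathcomp Require Import all_boot all_order all_algebra.
From mathcomp Require Import all_classical all_reals all_analysis.

Set Implicit Arguments.
Unset Strict Implicit.
Unset Printing Implicit Defensive.

Import Order.TTheory GRing.Theory Num.Theory.
Import numFieldNormedType.Exports.

Local Open Scope classical_set_scope.
Local Open Scope card_scope.
Local Open Scope ring_scope.

Record distance (R : realType) (T : Type) := Distance {
  dist_fun :> T -> T -> R ;
  dist_ge0 : forall x y, 0 <= dist_fun x y ;
  dist_eq0 : forall x y, dist_fun x y = 0 <-> x = y ;
  dist_sym : forall x y, dist_fun x y = dist_fun y x ;
  dist_triangle : forall x y z, dist_fun x z <= dist_fun x y + dist_fun y z
}.

(* An alias of T whose distance, uniformity and topology are those given by d,
   whatever structures T itself carries. *)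
Definition metric_space (R : realType) (T : choiceType) (d : distance R T)
  : Type := T.

Section metric_space_instance.
Context (R : realType) (T : choiceType) (d : distance R T).

HB.instance Definition _ := Choice.copy (metric_space d) T.

Let distxx (x : metric_space d) : d x x = 0.
Proof. exact/dist_eq0. Qed.

Let dist_pos (x y : metric_space d) : d x y = 0 -> x = y.
Proof. by move/dist_eq0. Qed.

Let dist_tri (y x z : metric_space d) : d x z <= d x y + d y z.
Proof. exact: dist_triangle. Qed.

HB.instance Definition _ := @isMetric.Build R (metric_space d) (dist_fun d)
  distxx dist_pos (@dist_sym _ _ d) dist_tri.

End metric_space_instance.

Definition translation_invariant (R : realType) (d : distance R R) : Prop :=
  forall x y v : R, d x y = d (x + v) (y + v).

(* The left-hand [open] is that of the metric topology of d. *)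
Definition induces_standard_topology (R : realType) (d : distance R R) : Prop :=
  forall U : set R, @open (metric_space d) U <-> @open R U.

Section metric_notions.
Context (R : realType) (X : metricType R).

(* This is not the library's [closed_ball], which is the closure of the open
   ball. *)
Definition mclosed_ball (x : X) (r : R) : set X := [set y | mdist x y <= r].

Definition proper_metric : Prop :=
  forall (x : X) (r : R), compact (mclosed_ball x r).

(* The diameter of the empty set is -oo here; it is only ever compared with
   nonnegative reals. *)
Definition diam (A : set X) : \bar R :=
  ereal_sup [set (mdist p.1 p.2)%:E | p in A `*` A].

Definition bounded_by (D : R) (F : set (set X)) : Prop :=
  forall B, F B -> (diam B <= D%:E)%E.

Definition meets_at_most (n : nat) (F : set (set X)) (A : set X) : Prop :=
  [set B | F B /\ A `&` B !=set0] #<= `I_n.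

(* +oo when no n is suitable. *)
Definition multiplicity (s : R) (F : set (set X)) : \bar R :=
  ereal_inf [set (n%:R)%:E | n in
    [set n : nat |
      forall A : set X, (diam A <= s%:E)%E -> meets_at_most n F A]].

Definition nagata_dim : \bar R :=
  ereal_inf [set (n%:R)%:E | n in
    [set n : nat | exists2 c : R, 0 < c & forall s : R, 0 < s ->
      exists F : set (set X), [/\ \bigcup_(B in F) B = setT,
        bounded_by (c * s) F & (multiplicity s F <= (n.+1%:R)%:E)%E]]].

Definition assouad_dim : \bar R :=
  ereal_inf [set beta%:E | beta in
    [set beta : R | 0 < beta /\ exists2 C : R, 1 < C &
      forall D eps : R, 0 < D -> 0 < eps < 1 ->
      forall A : set X, diam A = D%:E ->
      exists (F : set (set X)) (n : nat), [/\ A `<=` \bigcup_(B in F) B,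
        bounded_by (eps * D) F, F #<= `I_n & n%:R <= C * eps `^ (- beta)]]].

End metric_notions.

Definition bilipschitz_homeomorphic (R : realType) (X Y : metricType R)
    (U : set X) (V : set Y) : Prop :=
  exists f : X -> Y, set_bij U V f /\
    exists2 L : R, 0 < L & forall x y : X, U x -> U y ->
      L^-1 * mdist x y <= mdist (f x) (f y) <= L * mdist x y.

(* The metric carried by R^o is the Euclidean one, `|y - x|. *)
Definition locally_bilipschitz_line (R : realType) (X : metricType R) : Prop :=
  forall x : X, exists U : set X, [/\ open U, U x &
    exists V : set R^o, open V /\ bilipschitz_homeomorphic U V].

(* Main.v *)
Require Import Defs.
From HB Require Import structures.
From mathcomp Require Import all_boot all_order all_algebra.
From mathcomp Require Import all_classical all_reals all_analysis.
From mathcomp Require Import zify ring lra.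

(** The distance is [d x y = phi `|x - y|] with
    [phi t = t * (1 + ln (1 + t^-1))].  The factor [phi t / t] is nonincreasing
    and tends to infinity at [0], but only logarithmically; everything below
    comes from these facts and from the monotonicity of [phi].

    Since [phi t / t] is nonincreasing, [phi] is subadditive, so [d] is a
    distance.  It is an increasing homeomorphism of the half-line, so the balls
    of [d] are the Euclidean balls with other radii, which gives the topology
    and properness.

    [d] is not locally biLipschitz to the line because [phi t / t] is unbounded
    at [0]: the inverse of a biLipschitz chart would be a function [g] with
    [phi `|g y - g z| <= L * `|y - z|], hence with [`|g y - g z|] negligible
    before [`|y - z|].  Such a function is constant on intervals
    ([phi_lipschitz_const]).

    The logarithm is too slow to be seen by the dimensions.  For every [b > 1]
    there is a constant [c > 0] such that shrinking a length by the factor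
    [c * e `^ b] shrinks its [phi] by at least the factor [e]
    ([phi_contract]).  So a set of diameter [D] is covered by a constant
    multiple of [e `^ - b] intervals of diameter [e * D], and the Assouad
    dimension is at most any [b > 1].  Conversely [phi (m^-1) >= phi 1 / m] produces [m] points of
    the unit interval separated by [phi 1 / m], which excludes every exponent
    below [1].  The Nagata dimension is at most [1] thanks to consecutive
    half-open intervals of equal length, and it is not [0] because the line can
    be walked along with arbitrarily small steps. *)

Set Implicit Arguments.
Unset Strict Implicit.
Unset Printing Implicit Defensive.

Import Order.TTheory GRing.Theory Num.Theory.
Import numFieldNormedType.Exports.

Local Open Scope classical_set_scope.
Local Open Scope card_scope.
Local Open Scope ring_scope.

(** * A gauge with unbounded slope at the origin *)

Section gauge.
Context {R : realType}.
Implicit Types s t u M : R.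

(** The slope of the chord of the graph of [phi] from the origin to
    [(t, phi t)]. *)
Definition slope t : R := 1 + ln (1 + t^-1).

Definition phi t : R := t * slope t.

Lemma slope_ge1 t : 0 <= t -> 1 <= slope t.
Proof. by move=> t0; rewrite lerDl ln_ge0// lerDl invr_ge0. Qed.

Lemma slope_nincr t u : 0 < t -> t <= u -> slope u <= slope t.
Proof.
move=> t0 tu; have u0 : 0 < u := lt_le_trans t0 tu.
rewrite lerD2l ler_ln ?posrE ?addr_gt0 ?invr_gt0//.
by rewrite lerD2l lef_pV2 ?posrE.
Qed.

Lemma slope_unbounded M : exists2 u, 0 < u & forall t, 0 < t <= u -> M < slope t.
Proof.
exists (expR (- M)); first exact: expR_gt0.
move=> t /andP[t0 tu]; apply: lt_le_trans (slope_nincr t0 tu).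
rewrite /slope expRN invrK ltr_pwDl//.
by rewrite -[leLHS]expRK ler_ln ?posrE ?addr_gt0 ?expR_gt0// lerDr.
Qed.

Lemma phi0 : phi 0 = 0. Proof. exact: mul0r. Qed.

Lemma phi_ge_id t : 0 <= t -> t <= phi t.
Proof. by move=> t0; rewrite ler_peMr ?slope_ge1. Qed.

Lemma phi_ge0 t : 0 <= t -> 0 <= phi t.
Proof. by move=> t0; rewrite (le_trans t0)// phi_ge_id. Qed.

Lemma phi_gt0 t : 0 < t -> 0 < phi t.
Proof. by move=> t0; rewrite (lt_le_trans t0)// phi_ge_id// ltW. Qed.

(** The difference [phi u - phi t] is
    [(u - t) * slope u - t * (slope t - slope u)], and [ln (1 + x) <= x] bounds
    the last product by [(u - t) / (u + 1)]. *)
Lemma phi_incr t u : 0 <= t -> t < u -> phi t < phi u.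
Proof.
rewrite le_eqVlt => /predU1P[<- u0|t0 tu]; first by rewrite phi0 phi_gt0.
have u0 : 0 < u := lt_trans t0 tu.
have lnB : ln (1 + t^-1) - ln (1 + u^-1) <= (u - t) / (t * (u + 1)).
  rewrite -ln_div ?posrE ?addr_gt0 ?invr_gt0//.
  have -> : (1 + t^-1) / (1 + u^-1) = 1 + (u - t) / (t * (u + 1)).
    by field; rewrite !gt_eqF// ?addr_gt0.
  rewrite le_ln1Dx// (lt_trans (ltrN10 R))// divr_gt0 ?subr_gt0//.
  by rewrite mulr_gt0 ?addr_gt0.
have : t * (ln (1 + t^-1) - ln (1 + u^-1)) < u - t.
  apply: (@le_lt_trans _ _ (t * ((u - t) / (t * (u + 1))))).
    by rewrite ler_pM2l.
  have -> : t * ((u - t) / (t * (u + 1))) = (u - t) / (u + 1).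
    by field; rewrite !gt_eqF// ?addr_gt0.
  by rewrite ltr_pdivrMr ?addr_gt0// ltr_pMr ?subr_gt0// ltrDr.
have : 0 <= (u - t) * ln (1 + u^-1).
  by rewrite mulr_ge0 ?subr_ge0 ?(ltW tu)// ln_ge0// lerDl invr_ge0 ltW.
by rewrite /phi /slope; lra.
Qed.

Lemma phi_ndecr t u : 0 <= t -> t <= u -> phi t <= phi u.
Proof.
by move=> t0; rewrite le_eqVlt => /predU1P[->//|tu]; rewrite ltW// phi_incr.
Qed.

Lemma phi_le_cancel t u : 0 <= u -> phi t <= phi u -> t <= u.
Proof. by move=> u0; rewrite !leNgt; apply: contra => ut; exact: phi_incr. Qed.

(** Both summands keep at least the chord slope of the sum. *)
Lemma phi_subadditive t u : 0 <= t -> 0 <= u -> phi (t + u) <= phi t + phi u.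
Proof.
rewrite le_eqVlt => /predU1P[<-|t0]; first by rewrite phi0 !add0r.
rewrite le_eqVlt => /predU1P[<-|u0]; first by rewrite phi0 !addr0.
by rewrite /phi mulrDl lerD// ler_pM2l// slope_nincr// ?lerDl ?lerDr ltW.
Qed.

(** This is where the slow growth enters: [1 + (l * t)^-1] is at most
    [l^-1 * (1 + t^-1)], so a change of scale costs a logarithm additively, and
    [slope t >= 1] makes the cost multiplicative and uniform in [t]. *)
Lemma slope_scale l t : 0 < l -> l <= 1 -> 0 < t ->
  slope (l * t) <= (1 + ln l^-1) * slope t.
Proof.
move=> l0 l1 t0; have lV1 : 1 <= l^-1 by rewrite invf_ge1.
have lnl : 0 <= ln l^-1 by rewrite ln_ge0.
apply: (@le_trans _ _ (slope t + ln l^-1)).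
  rewrite -addrA lerD2l addrC -lnM ?posrE ?invr_gt0 ?addr_gt0 ?invr_gt0//.
  rewrite ler_ln ?posrE ?mulr_gt0 ?invr_gt0 ?addr_gt0 ?invr_gt0 ?mulr_gt0//.
  by rewrite mulrDr mulr1 invfM lerD2r.
by rewrite mulrDl mul1r lerD2l ler_peMr// slope_ge1// ltW.
Qed.

(** With [l] the factor in front of [t], [slope_scale] leaves
    [l * (1 + ln l^-1) <= e] to prove.  The constant [1 - b^-1] makes
    this a consequence of [ln z <= z - 1] at [z = ((1 - b^-1) * e) `^ (1 - b)]. *)
Lemma phi_contract (b e t : R) : 1 < b -> 0 < e -> e <= 1 -> 0 <= t ->
  phi (((1 - b^-1) * e) `^ b * t) <= e * phi t.
Proof.
move=> b1 e0 e1; rewrite le_eqVlt => /predU1P[<-|t0].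
  by rewrite mulr0 phi0 mulr0.
have b0 : 0 < b by rewrite (lt_trans _ b1).
set a := 1 - b^-1.
have a0 : 0 < a by rewrite subr_gt0 invf_lt1.
have a1 : a < 1 by rewrite ltrBlDr ltrDl invr_gt0.
have ae0 : 0 < a * e by rewrite mulr_gt0.
have ae1 : a * e <= 1 by rewrite mulr_ile1// ltW.
set l := (a * e) `^ b.
have l0 : 0 < l by rewrite powR_gt0.
have l1 : l <= 1.
  by rewrite -(powRr0 (a * e)) ger_powR ?ae0 ?ae1//= ltW.
suff ll : l * (1 + ln l^-1) <= e.
  apply: (@le_trans _ _ (l * (1 + ln l^-1) * phi t)).
    rewrite /phi -!mulrA ler_pM2l// [leRHS]mulrCA ler_pM2l//.
    exact: slope_scale.
  by rewrite ler_pM2r ?phi_gt0.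
set y := (a * e)^-1; have y0 : 0 < y by rewrite invr_gt0.
have lV : l^-1 = y `^ b.
  by rewrite /l /y -(powRN (a * e)) -powR_inv1 ?ltW// -powRrM mulN1r.
have lnly : (b - 1) * ln y <= y `^ (b - 1) - 1.
  rewrite -ln_powR -[X in ln X](subrK 1) addrC le_ln1Dx//.
  by rewrite ltrBrDl subrr powR_gt0.
rewrite lV ln_powR -[l]invrK lV ler_pdivrMl ?powR_gt0//.
have -> : y `^ b * e = a^-1 * y `^ (b - 1).
  rewrite -(mulr_powRB1 (ltW y0) b0) /y invfM.
  by field; rewrite !gt_eqF.
rewrite ler_pdivlMl//.
have -> : a * (1 + b * ln y) = a + (b - 1) * ln y.
  by rewrite /a; field; rewrite gt_eqF.
lra.
Qed.

Lemma phi_continuous t : 0 < t -> {for t, continuous phi}.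
Proof.
move=> t0; apply: continuousM; first exact: cvg_id.
apply: continuousD; first exact: cvg_cst.
apply: (@continuous_comp R R R (fun x => 1 + x^-1) (@ln R) t).
  apply: continuousD; first exact: cvg_cst.
  by apply: inv_continuous; rewrite gt_eqF.
by apply: continuous_ln; rewrite addr_gt0 ?invr_gt0.
Qed.

(** The intermediate value theorem between [u] and [s]; [phi_contract]
    supplies a [u > 0] with [phi u <= s], so that the continuity of [phi] is
    only needed away from [0]. *)
Lemma phi_surj s : 0 <= s -> exists2 t, 0 <= t & phi t = s.
Proof.
rewrite le_eqVlt => /predU1P[<-|s0]; first by exists 0; rewrite ?phi0.
set e := s / phi s.
have ps0 := phi_gt0 s0; have sps := phi_ge_id (ltW s0).
have e0 : 0 < e by rewrite divr_gt0.
have e1 : e <= 1 by rewrite ler_pdivrMr// mul1r.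
set u := ((1 - 2^-1) * e) `^ 2 * s.
have u0 : 0 < u by rewrite mulr_gt0// powR_gt0// mulr_gt0// subr_gt0 invf_lt1// ltr1n.
have pus : phi u <= s.
  by rewrite (le_trans (phi_contract _ e0 e1 (ltW s0))) ?ltr1n// divfK ?gt_eqF.
have us : u <= s by rewrite (le_trans _ pus)// phi_ge_id// ltW.
have [||t /[!in_itv]/= /andP[ut _] <-] := @IVT _ phi u s s us.
- apply: continuous_in_subspaceT => x /[!inE]/= /[!in_itv]/= /andP[ux _].
  exact: phi_continuous (lt_le_trans u0 ux).
- by rewrite ge_min pus/= le_max sps orbT.
by exists t => //; rewrite (le_trans (ltW u0)).
Qed.

Lemma phi_surj_gt0 s : 0 < s -> exists2 t, 0 < t & phi t = s.
Proof.
move=> s0; have [t t0 ts] := phi_surj (ltW s0); exists t => //.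
by move: t0; rewrite le_eqVlt => /predU1P[t0|//]; rewrite -ts -t0 phi0 ltxx in s0.
Qed.

End gauge.

(** * Cardinality, diameter and multiplicity *)

Lemma card_le1_eq T (A : set T) x y : A #<= `I_1 -> A x -> A y -> x = y.
Proof.
move=> /pcard_leP[f] Ax Ay; apply: (@inj _ _ _ f); rewrite ?inE//.
have fx : (f x < 1)%N by exact: (@funS _ _ _ _ f).
have fy : (f y < 1)%N by exact: (@funS _ _ _ _ f).
by move: fx fy; rewrite !ltnS !leqn0 => /eqP fx /eqP fy; rewrite [LHS]fx [RHS]fy.
Qed.

Lemma card_le_set2 T (A : set T) x y : A `<=` [set x; y] -> A #<= `I_2.
Proof.
move=> Axy; apply: (@card_le_trans _ _ _ [set x; y]); first exact: subset_card_le.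
apply: card_le_trans (card_image_le (fun i => if i is 0%N then x else y) `I_2).
by apply: subset_card_le => _ [->|->]; [exists 0%N|exists 1%N].
Qed.

Section metric_notions.
Context {R : realType} {X : metricType R}.
Implicit Types (A : set X) (F : set (set X)) (s : R).

Lemma diam_leP A s :
  (diam A <= s%:E)%E <-> forall x y, A x -> A y -> mdist x y <= s.
Proof.
split=> [As x y Ax Ay|As].
  rewrite -lee_fin; apply: le_trans As.
  by apply: ereal_sup_ubound; exists (x, y).
by apply: ge_ereal_sup => _ [[x y] [/= Ax Ay] <-]; rewrite lee_fin As.
Qed.

(** The infimum runs over naturals, so it is attained. *)
Lemma multiplicity_leP F s n : (multiplicity s F <= (n%:R)%:E)%E <->
  forall A, (diam A <= s%:E)%E -> meets_at_most n F A.
Proof.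
split=> [sFn A As|sF]; last by apply: ereal_inf_lbound; exists n.
have : (multiplicity s F < (n.+1%:R)%:E)%E.
  by rewrite (le_lt_trans sFn)// lte_fin ltr_nat.
move=> /ereal_inf_lt[_ [m /= mF <-]]; rewrite lte_fin ltr_nat ltnS => mn.
by apply: card_le_trans (mF A As) _; rewrite card_le_II.
Qed.

End metric_notions.

(** * The distance and its topology *)

Section line.
Context {R : realType}.
Implicit Types x y : R.

Let phid x y := phi `|x - y|.

Let phid_ge0 x y : 0 <= phid x y.
Proof. exact: phi_ge0. Qed.

Let phid_eq0 x y : phid x y = 0 <-> x = y.
Proof.
split=> [xy|->]; last by rewrite /phid subrr normr0 phi0.
apply/eqP; rewrite -subr_eq0 -normr_le0.
by rewrite -[leRHS]xy phi_ge_id.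
Qed.

Let phid_sym x y : phid x y = phid y x.
Proof. by rewrite /phid distrC. Qed.

Let phid_triangle x y z : phid x z <= phid x y + phid y z.
Proof.
apply: le_trans (phi_subadditive _ _) => //.
by apply: phi_ndecr => //; rewrite -[x - z](subrKA y) ler_normD.
Qed.

Definition phi_distance : distance R R :=
  Distance phid_ge0 phid_eq0 phid_sym phid_triangle.

Local Notation X := (metric_space phi_distance).

Lemma mdist_phiE (x y : X) : mdist x y = phi (`|(x : R) - (y : R)|).
Proof. by []. Qed.

Lemma phi_distance_translation : translation_invariant phi_distance.
Proof. by move=> x y v /=; rewrite /phid opprD addrACA subrr addr0. Qed.

(** A [d]-ball of radius [e] is the Euclidean ball of radius [r] with
    [phi r = e]; a Euclidean ball contains the [d]-ball of the same radius
    because [t <= phi t]. *)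
Lemma nbhs_phiE (x : R) (A : set R) : @nbhs X X x A <-> @nbhs R R x A.
Proof.
split=> [/(@nbhs_ballP R X)[e /= e0 eA]|/(@nbhs_ballP R R)[e /= e0 eA]].
  have [r r0 re] := phi_surj_gt0 e0.
  apply/(@nbhs_ballP R R); exists r => //= y xy; apply: eA.
  by rewrite ballEmdist/= mdist_phiE -re phi_incr.
apply/(@nbhs_ballP R X); exists e => //= y.
rewrite ballEmdist/= mdist_phiE => xy; apply: eA.
by apply: le_lt_trans xy; exact: phi_ge_id.
Qed.

Lemma phi_distance_topology : induces_standard_topology phi_distance.
Proof.
by move=> U; rewrite !openE; split=> UU x /UU; rewrite /interior/= => /nbhs_phiE.
Qed.

(** A closed ball of radius [phi t] is a segment of half-length [t]. *)
Lemma phi_distance_proper : proper_metric X.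
Proof.
move=> x r; have [r0|r0] := ltP r 0.
  suff -> : mclosed_ball x r = set0 by exact: compact0.
  rewrite -subset0 => y; rewrite /mclosed_ball/= => xy.
  by have := le_lt_trans (le_trans (mdist_ge0 _ _) xy) r0; rewrite ltxx.
have [t t0 rE] := phi_surj r0.
have -> : mclosed_ball x r = (fun y : R => y : X) @` `[(x : R) - t, (x : R) + t].
  apply/seteqP; split=> [y|_ [y /= + <-]]; rewrite /mclosed_ball/= mdist_phiE -rE.
    move=> /(phi_le_cancel t0) xy; exists y => //=.
    by rewrite in_itv/= -ler_distlC.
  by rewrite in_itv/= -ler_distlC => xy; exact: phi_ndecr.
apply: (@continuous_compact R X); last exact: segment_compact.
by apply: continuous_subspaceT => y A /nbhs_phiE.
Qed.

(** * Nagata dimension *)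

(** Indexing the half-open intervals of length [r] by [floor] makes the index of
    the interval through a given point explicit. *)
Definition cell (r : R) (k : int) : set R := [set x | Num.floor (x / r) = k].

Lemma cell_dist_le r k x y : 0 < r -> cell r k x -> cell r k y -> `|x - y| <= r.
Proof.
move=> r0 xk yk; have /andP[xl xu] := floor_itv (x / r).
have /andP[yl yu] := floor_itv (y / r).
rewrite xk in xl xu; rewrite yk in yl yu.
rewrite -[r]mul1r -ler_pdivrMr// -{1}(gtr0_norm r0) -normf_div mulrBl.
rewrite intrD in xu yu.
by rewrite ler_norml; apply/andP; split; lra.
Qed.

Lemma floor_sub_lt r x y (l : R) : 0 < r -> y - x <= l * r ->
  (Num.floor (y / r) - Num.floor (x / r))%:~R < l + 1.
Proof.
move=> r0; rewrite -ler_pdivrMr// mulrBl intrB => yx.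
have := floor_le (y / r); have := floorD1_gt (x / r); rewrite intrD => ? ?; lra.
Qed.

Lemma diam_cell_le r k : 0 < r -> (diam (cell r k : set X) <= (phi r)%:E)%E.
Proof.
move=> r0; apply/diam_leP => x y xk yk; rewrite mdist_phiE.
by apply: phi_ndecr => //; exact: cell_dist_le xk yk.
Qed.

(** With [phi r = s], two points at [d]-distance at most [s] have [floor]
    indices differing by at most [1], so all the indices met by a set of
    diameter at most [s] lie in a pair of consecutive integers. *)
Lemma nagata_dim_le1 : (nagata_dim X <= 1)%E.
Proof.
apply: ereal_inf_lbound; exists 1%N => //=; exists 1 => // s s0.
have [r r0 rs] := phi_surj_gt0 s0.
exists (range (cell r)); split.
- apply/seteqP; split=> // x _; set k := Num.floor ((x : R) / r).
  by exists (cell r k) => //; exists k.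
- by move=> _ [k _ <-]; rewrite mul1r -rs; exact: diam_cell_le.
apply/multiplicity_leP => A /diam_leP As.
have step (x y : R) : A x -> A y -> Num.floor (y / r) <= Num.floor (x / r) + 1.
  move=> Ax Ay; have /floor_sub_lt : y - x <= 1 * r.
    rewrite mul1r (le_trans (ler_norm _))// (phi_le_cancel (ltW r0))// rs.
    exact: As.
  by move=> /(_ r0); rewrite -[1 + 1]/(2%:~R) ltr_int; lia.
have [[x Ax]|noA] := pselect (exists x, A x); last first.
  by apply: (@card_le_set2 _ _ set0 set0) => B [_ [z [Az _]]]; case: noA; exists z.
set k := Num.floor ((x : R) / r).
have [[y Ay yk]|noy] := pselect (exists2 y : R, A y & Num.floor (y / r) < k).
  apply: (@card_le_set2 _ _ (cell r (k - 1)) (cell r k)) => _ [[j _ <-] [z [Az jz]]].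
  have := step _ _ Ax Ay; have := step _ _ Ay Az; have := step _ _ Az Ax.
  rewrite jz -/k => ? ? ?.
  have [->|->] : j = k - 1 \/ j = k by lia.
    by left.
  by right.
apply: (@card_le_set2 _ _ (cell r k) (cell r (k + 1))) => _ [[j _ <-] [z [Az jz]]].
have /negP : ~ (j < k) by rewrite -jz => jk; apply: noy; exists z.
have := step _ _ Ax Az; rewrite jz -/k => ? ?.
have [->|->] : j = k \/ j = k + 1 by lia.
  by left.
by right.
Qed.

(** In a cover of [1]-multiplicity [1], two points at distance at most [1] share
    their unique member.  Walking with steps of length [r], where [phi r = 1],
    the member through [0] contains all [k * r], so it is unbounded. *)
Lemma nagata_dim_ge1 : (1 <= nagata_dim X)%E.
Proof.
apply: le_ereal_inf_tmp => _ [[|n] [/= c c0 /(_ 1 ltr01)] [F [Fcov Fb Fm]] <-].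
  exfalso; move/multiplicity_leP: Fm => Fm.
  have [r r0 rs] := @phi_surj_gt0 R 1 ltr01.
  have [B FB B0] : (\bigcup_(B in F) B) (0 : R) by rewrite Fcov.
  have Bk k : B (k%:R * r : R).
    elim: k => [|k Bk]; first by rewrite mul0r.
    have [B' FB' B'k] : (\bigcup_(B in F) B) (k.+1%:R * r : R) by rewrite Fcov.
    set A : set X := [set (k%:R * r : R); (k.+1%:R * r : R)].
    suff /Fm A1 : (diam A <= 1%:E)%E.
      have -> // : B = B'.
      apply: (card_le1_eq A1); split=> //.
        by exists (k%:R * r); split=> //; left.
      by exists (k.+1%:R * r); split=> //; right.
    apply/diam_leP => x y Ax Ay; rewrite mdist_phiE -rs; apply: phi_ndecr => //.
    have kE : k.+1%:R * r = k%:R * r + r by rewrite -addn1 natrD mulrDl mul1r.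
    rewrite ler_norml; apply/andP.
    by case: Ax Ay => -> [] ->; rewrite ?kE; split; lra.
  set k := (Num.truncn (c / r)).+1.
  have : mdist (0 : X) (k%:R * r : R) <= c * 1 by move/diam_leP: (Fb _ FB); apply.
  rewrite mdist_phiE mulr1 sub0r normrN leNgt => /negP; apply.
  apply: lt_le_trans (phi_ge_id _) => //.
  by rewrite ger0_norm ?mulr_ge0 ?(ltW r0)// -ltr_pdivrMr// truncnS_gt.
by rewrite lee_fin ler1n.
Qed.

Lemma phi_distance_nagata : nagata_dim X = 1%E.
Proof. by apply/eqP; rewrite eq_le nagata_dim_le1 nagata_dim_ge1. Qed.


(** * Assouad dimension *)

(** If [phi r = D], a set of diameter [D] lies in an interval of length [2 * r];
    by [phi_contract] the cells of length [l * r] have diameter at most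
    [eps * D], and at most [2 / l + 2] of them are needed.  Here [l^-1] is a
    constant times [eps `^ - b]. *)
Lemma assouad_dim_le1 : (assouad_dim X <= 1)%E.
Proof.
apply/lee_addgt0Pr => e e0; apply: ereal_inf_lbound; exists (1 + e) => //.
set b := 1 + e; have b1 : 1 < b by rewrite ltrDl.
have b0 : 0 < b by rewrite (lt_trans _ b1).
split=> //; set a := 1 - b^-1.
have a0 : 0 < a by rewrite subr_gt0 invf_lt1.
have a1 : a <= 1 by rewrite lerBlDr lerDl invr_ge0 ltW.
exists (4 * a `^ (- b)).
  rewrite powRN; have : 1 <= (a `^ b)^-1.
    by rewrite invf_ge1 ?powR_gt0// -(powRr0 a) ger_powR ?a0 ?a1//= ltW.
  lra.
move=> D eps D0 /andP[eps0 eps1] A AD.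
have [r r0 rD] := phi_surj_gt0 D0.
set l := (a * eps) `^ b.
have l0 : 0 < l by rewrite powR_gt0// mulr_gt0.
have l1 : l <= 1.
  have ae1 : a * eps <= 1 by apply: mulr_ile1 => //; exact: ltW.
  by rewrite -(powRr0 (a * eps)) ger_powR ?mulr_gt0//= ltW.
have lr0 : 0 < l * r by rewrite mulr_gt0.
have AdD (x y : R) : A x -> A y -> `|x - y| <= r.
  move=> Ax Ay; apply: (phi_le_cancel (ltW r0)); rewrite rD.
  by move: x y Ax Ay; apply/(@diam_leP _ X); rewrite AD.
have [[x0 Ax0]|noA] := pselect (exists x, A x); last first.
  exists set0, 0%N; split=> //.
  - by move=> x Ax; case: noA; exists x.
  - by rewrite mulr_ge0 ?powR_ge0// mulr_ge0 ?powR_ge0.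
pose k0 := Num.floor (((x0 : R) - r) / (l * r)).
pose n := (Num.truncn (2 / l + 1)).+1.
exists [set cell (l * r) (k0 + i%:Z) | i in `I_n], n; split.
- move=> y Ay; have yx : 0 <= y - ((x0 : R) - r) <= 2 / l * (l * r).
    have -> : 2 / l * (l * r) = 2 * r by field; rewrite gt_eqF.
    have := AdD _ _ Ay Ax0; rewrite ler_norml => /andP[? ?].
    by apply/andP; split; lra.
  case/andP: yx => yx0 /(floor_sub_lt lr0) yk.
  set k := Num.floor ((y : R) / (l * r)) in yk.
  have kk0 : k0 <= k by apply: le_floor; rewrite ler_pM2r ?invr_gt0// -subr_ge0.
  exists (cell (l * r) k) => //; exists `|k - k0|%N => /=; last first.
    by rewrite gez0_abs ?subr_ge0// (addrC k0) subrK.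
  rewrite /n ltnS truncn_ge_nat ?addr_ge0 ?divr_ge0 ?(ltW l0)//.
  by rewrite natr_absz ger0_norm ?subr_ge0// ltW.
- move=> _ [i _ <-]; apply: le_trans (diam_cell_le _ lr0) _.
  by rewrite lee_fin -rD phi_contract// ltW.
- exact: card_image_le.
have nl : n%:R <= 2 / l + 2.
  have : (Num.truncn (2 / l + 1))%:R <= 2 / l + 1.
    by rewrite truncn_le// addr_ge0 ?divr_ge0 ?(ltW l0).
  by rewrite /n -natr1; lra.
apply: (le_trans nl).
have -> : 4 * a `^ (- b) * eps `^ (- b) = 4 / l.
  by rewrite -mulrA -powRM ?(ltW a0) ?(ltW eps0)// powRN.
have : 1 <= l^-1 by rewrite invf_ge1.
lra.
Qed.

(** The points [j / m] of the unit interval are at mutual distance at least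
    [phi 1 / m], so sets of diameter at most [phi 1 / (2 * m)] contain at most
    one of them.  An exponent [b < 1] would then give [m <= K * m `^ b] for
    every [m]. *)
Lemma assouad_dim_ge1 : (1 <= assouad_dim X)%E.
Proof.
apply: le_ereal_inf_tmp => _ [b [/= b0 [C C1 bC]] <-].
rewrite lee_fin leNgt; apply/negP => b1.
have C0 : 0 < C by rewrite (lt_trans _ C1).
have p1 : 0 < phi (1 : R) by exact: phi_gt0.
pose A : set X := [set x : R | 0 <= x <= 1].
have A1 : diam A = (phi 1)%:E.
  apply/eqP; rewrite eq_le; apply/andP; split.
    apply/diam_leP => x y /andP[x0 x1] /andP[y0 y1].
    by rewrite mdist_phiE; apply: phi_ndecr => //; rewrite ler_norml; apply/andP; split; lra.
  apply: ereal_sup_ubound; exists ((1 : R), (0 : R)) => /=.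
    by split; rewrite /A/= ?lexx ler01.
  by rewrite mdist_phiE subr0 normr1.
set K := C * 2 `^ b.
have K0 : 0 < K by rewrite mulr_gt0// powR_gt0.
pose m := (Num.truncn (K `^ (1 - b)^-1)).+1.
have m0 : 0 < m%:R :> R by rewrite ltr0n.
have Km : K < m%:R `^ (1 - b).
  have d0 : 0 < 1 - b by rewrite subr_gt0.
  have : K `^ (1 - b)^-1 < m%:R by exact: truncnS_gt.
  move=> /(gt0_ltr_powR d0); rewrite !nnegrE powR_ge0 ler0n => /(_ isT isT).
  by rewrite -powRrM mulVf ?gt_eqF// powRr1// ltW.
have eps01 : 0 < (2 * m%:R : R)^-1 < 1.
  by rewrite invr_gt0 mulr_gt0//= invf_lt1 ?mulr_gt0// -natrM ltr1n mul2n -addnn addnS.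
have [F [n [AF Fb Fn nC]]] := bC _ _ p1 eps01 A A1.
pose p (j : nat) : R := j%:R / m%:R.
have pA j : (j < m)%N -> A (p j).
  move=> jm; rewrite /A/= divr_ge0//= ler_pdivrMr// mul1r ler_nat ltnW//.
have pdist i j : (i < j)%N -> (2 * m%:R)^-1 * phi 1 < phi `|p i - p j|.
  move=> ij; apply: (@lt_le_trans _ _ (m%:R^-1 * phi 1)).
    by rewrite ltr_pM2r// invfM gtr_pMl ?invr_gt0// invf_lt1// ltr1n.
  apply: (@le_trans _ _ (phi m%:R^-1)).
    rewrite /phi mul1r ler_pM2l ?invr_gt0// slope_nincr ?invr_gt0//.
    by rewrite invf_le1// ler1n.
  apply: phi_ndecr; first by rewrite invr_ge0 ltW.
  rewrite distrC /p -mulrBl -natrB ?(ltnW ij)// ger0_norm ?divr_ge0//.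
  by rewrite ler_peMl ?invr_ge0 ?(ltW m0)// ler1n subn_gt0.
have : `I_m #<= F.
  have /choice[f fP] j : exists B : set X, (j < m)%N -> F B /\ B (p j).
    have [/pA/AF[B FB Bp]|] := pselect (j < m)%N; first by exists B.
    by move=> jm; exists set0.
  have finj : {in `I_m &, injective f}.
    have sep i j : (j < m)%N -> (i < j)%N -> f i <> f j.
      move=> jm ij fij; have := pdist _ _ ij; rewrite ltNge => /negP; apply.
      have [Fj pj] := fP _ jm; have [_ pi] := fP _ (ltn_trans ij jm).
      by move/diam_leP: (Fb _ Fj) => /(_ (p i) (p j)); rewrite -{1}fij; exact.
    move=> i j /[!inE]/= im jm fij.
    by have [ij|ij|//] := ltngtP i j; [case: (sep _ _ jm ij)|case: (sep _ _ im ij)].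
  rewrite -(card_le_eql (inj_card_eq finj)); apply: subset_card_le.
  by move=> _ [j /= jm <-]; case: (fP _ jm).
move=> /card_le_trans/(_ Fn); rewrite card_le_II => mn.
have : m%:R <= K * m%:R `^ b.
  apply: (@le_trans _ _ n%:R); first by rewrite ler_nat.
  rewrite (le_trans nC)// -powR_inv1 ?mulr_ge0 ?(ltW m0)// -powRrM.
  by rewrite mulrNN mul1r powRM ?(ltW m0)// mulrA.
rewrite leNgt => /negP; apply.
rewrite -[ltRHS]powRr1 ?(ltW m0)// -[X in _ < _ `^ X](subrK b) powRD; last first.
  by rewrite (gt_eqF m0) implybT.
by rewrite ltr_pM2r ?powR_gt0.
Qed.

Lemma phi_distance_assouad : assouad_dim X = 1%E.
Proof. by apply/eqP; rewrite eq_le assouad_dim_le1 assouad_dim_ge1. Qed.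

(** * Failure of the local biLipschitz property *)

(** Cut the interval into [n] equal pieces.  On each, [g] moves by some [t] with
    [t * slope t <= K * d / n], and [slope t] exceeds any given bound once [n]
    is large; adding up, [g] moves by less than any positive amount. *)
Lemma phi_lipschitz_const (g : R -> R) (y0 d K : R) : 0 < d -> 0 < K ->
  (forall y z, y0 <= y <= y0 + d -> y0 <= z <= y0 + d ->
     phi `|g y - g z| <= K * `|y - z|) ->
  g y0 = g (y0 + d).
Proof.
move=> d0 K0 gK; apply/eqP; rewrite -subr_eq0 -normr_le0 leNgt.
apply/negP; set c := `|_| => c0.
(* Any bound larger than [K * d / c] contradicts the total displacement [c]. *)
have [u u0 uM] := @slope_unbounded R ((K * d + 1) / c).
pose n := (Num.truncn (K * d / u)).+1.
have n0 : 0 < n%:R :> R by rewrite ltr0n.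
pose w := K * (d / n%:R).
have w0 : 0 < w by rewrite mulr_gt0// divr_gt0.
have wu : w <= u.
  by rewrite /w mulrA ler_pdivrMr// -ler_pdivrMl// mulrC ltW// truncnS_gt.
pose Y (j : nat) := y0 + j%:R * (d / n%:R).
have Yin j : (j <= n)%N -> y0 <= Y j <= y0 + d.
  move=> jn; rewrite lerDl mulr_ge0 ?divr_ge0 ?(ltW d0)//= lerD2l.
  by rewrite mulrA ler_pdivrMr// mulrC ler_pM2l// ler_nat.
have YS j : Y j.+1 = Y j + d / n%:R by rewrite /Y -natr1 mulrDl mul1r addrA.
have step j : (j < n)%N -> `|g (Y j) - g (Y j.+1)| * ((K * d + 1) / c) <= w.
  move=> jn; have := gK _ _ (Yin _ (ltnW jn)) (Yin _ jn).
  rewrite YS opprD addNKr normrN (gtr0_norm (divr_gt0 d0 n0)) -/w -YS.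
  set t := `|_ - _| => tw.
  have [->|t0] := eqVneq t 0; first by rewrite mul0r ltW.
  have {}t0 : 0 < t by rewrite lt_neqAle eq_sym t0 /=; exact: normr_ge0.
  have tu : t <= u := le_trans (phi_ge_id (ltW t0)) (le_trans tw wu).
  by apply: le_trans tw; rewrite /phi ler_pM2l//; apply/ltW/uM; rewrite t0.
have sum j : (j <= n)%N -> `|g y0 - g (Y j)| * ((K * d + 1) / c) <= j%:R * w.
  elim: j => [_|j IH jn]; first by rewrite /Y !mul0r addr0 subrr normr0 mul0r.
  have := IH (ltnW jn); have := step _ jn.
  rewrite -natr1 [(_ + 1) * w]mulrDl mul1r => h1 h2; apply: le_trans (lerD h2 h1).
  rewrite -mulrDl ler_pM2r ?divr_gt0 ?addr_gt0 ?mulr_gt0//.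
  by rewrite -[g y0 - _](subrKA (g (Y j))) ler_normD.
have := sum n (leqnn n).
have -> : Y n = y0 + d by rewrite /Y mulrCA divff ?mulr1// gt_eqF.
have -> : n%:R * w = K * d by rewrite /w; field; rewrite gt_eqF.
by rewrite -/c mulrC divfK ?gt_eqF//; lra.
Qed.

(** The constancy lemma applies to the inverse of a chart around [0], which is
    injective. *)
Lemma phi_distance_not_locally_line : ~ locally_bilipschitz_line X.
Proof.
move=> /(_ (0 : R))[U [_ U0 [V [Vo [f [Uf [L L0 fL]]]]]]].
have Vf0 : V (f (0 : R)) by exact: (set_bij_homo Uf).
move: Vo; rewrite openE => /(_ _ Vf0)/(@nbhs_ballP R R)[d /= d0 dV].
have inV y : f (0 : R) <= y <= (f (0 : R) : R) + d / 2 -> V y.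
  case/andP=> y1 y2; apply: dV; rewrite /ball/= distrC ltr_norml.
  by apply/andP; split; lra.
have /choice[g gP] (y : R) : exists x : R, V y -> U x /\ f x = y.
  have [/(set_bij_surj Uf)[x Ux <-]|nVy] := pselect (V y); first by exists x.
  by exists 0.
have gc : g (f (0 : R)) = g ((f (0 : R) : R) + d / 2).
  apply: (@phi_lipschitz_const g _ _ L) => [||y z /inV Vy /inV Vz] //.
    by rewrite divr_gt0.
  have [Uy fy] := gP _ Vy; have [Uz fz] := gP _ Vz.
  have /andP[+ _] := fL _ _ Uy Uz.
  by rewrite mdist_phiE fy fz ler_pdivrMl// [mdist _ _]distrC.
have [_ f0E] := gP _ Vf0.
have [|_ f1E] := gP ((f (0 : R) : R) + d / 2).
  by apply: inV; apply/andP; split; lra.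
by move: f1E; rewrite -gc f0E; lra.
Qed.

End line.

Theorem proposition1p13 (R : realType) :
  exists d : distance R R,
    proper_metric (metric_space d) /\
    translation_invariant d /\
    induces_standard_topology d /\
    assouad_dim (metric_space d) = 1%E /\
    nagata_dim (metric_space d) = 1%E /\
    ~ locally_bilipschitz_line (metric_space d).
Proof.
exists phi_distance; split; first exact: phi_distance_proper.
split; first exact: phi_distance_translation.
split; first exact: phi_distance_topology.
split; first exact: phi_distance_assouad.
split; first exact: phi_distance_nagata.
exact: phi_distance_not_locally_line.
Qed.
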